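(* Let $A\in\mathbb{C}^{N\times N}$, $\mathbf{b}\in\mathbb{C}^N$, let the columns of $V_m\in\mathbb{C}^{N\times m}$ form a basis of the Krylov space $\mathcal{K}_m(A,\mathbf{b})$, let $\varepsilon\in[0,1)$, and let $S\in\mathbb{C}^{s\times N}$ be such that $$(1-\varepsilon)\|\mathbf{v}\|^2\le\|S\mathbf{v}\|^2\le(1+\varepsilon)\|\mathbf{v}\|^2\qquad\text{for all }\mathbf{v}\in\mathcal{K}_{m+1}(A,\mathbf{b}).$$ Assume that $SV_m$ has orthonormal columns, i.e. $(SV_m)^HSV_m=I_m$. Let $$\mathbf{f}_m=V_m f(V_m^\dagger AV_m)V_m^\dagger\mathbf{b},\qquad \widehat{\mathbf{f}}_m=V_m f\big(V_m^HS^HSAV_m\big)V_m^HS^HS\mathbf{b}$$ denote the FOM and the sketched FOM approximants to $f(A)\mathbf{b}$, respectively. Then $$\|\mathbf{f}_m-\widehat{\mathbf{f}}_m\|\le\sqrt{\frac{1+\varepsilon}{1-\varepsilon}}\cdot\|\mathbf{b}\|\cdot\big\|f(V_m^\dagger AV_m)-f\big(V_m^HS^HSAV_m\big)\big\|.$$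
   Context: $\|\cdot\|$ is the Euclidean vector norm and the induced spectral matrix norm; $^H$ is the conjugate transpose and $^\dagger$ the Moore--Penrose inverse. The Krylov space is $\mathcal{K}_m(A,\mathbf{b})=\mathrm{span}\{\mathbf{b},A\mathbf{b},\dots,A^{m-1}\mathbf{b}\}$. $f$ is a scalar function for which the matrix functions $f(V_m^\dagger AV_m)$ and $f(V_m^HS^HSAV_m)$ are defined (so that both approximants are well defined). $V_m$ need not have orthonormal columns. *)

(* Defs.v *)
From HB Require Import structures.
From mathcomp Require Import all_boot all_order all_algebra complex.
From mathcomp Require Import boolp classical_sets reals topology normedtype.
From mathcomp Require Import derive.

Set Implicit Arguments.
Unset Strict Implicit.
Unset Printing Implicit Defensive.

Import Order.TTheory GRing.Theory Num.Theory.
Import numFieldNormedType.Exports.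

Local Open Scope classical_set_scope.
Local Open Scope sesquilinear_scope.
Local Open Scope ring_scope.

(** ** Matrix functions, by Hermite interpolation on the spectrum *)

(* [z] is an eigenvalue of [M] iff [0 < eig_index M z]; the multiplicity of [z]
   in the minimal polynomial is the size of its largest Jordan block. *)
Definition eig_index (C : fieldType) n (M : 'M[C]_n.+1) (z : C) : nat :=
  mup z (mxminpoly M).

(* A scalar function with domain [D] is given by a total [f : C -> C] whose
   values outside of [D] are irrelevant: [has_derivn D f k z] says that the
   [k]-th derivative of [f] at [z] exists, the [k.-1]-th one being defined in a
   neighbourhood of [z] contained in [D]; for [k = 0] it only says [D z]. *)
Fixpoint has_derivn (C : numClosedFieldType) (D : set C) (f : C -> C)
    (k : nat) (z : C) : Prop :=
  if k is k'.+1 then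
    (\forall w \near z, has_derivn D f k' w) /\ derivable (f^`(k')%classic) z 1
  else D z.

Definition defined_on_spectrum (C : numClosedFieldType) (D : set C)
    (f : C -> C) n (M : 'M[C]_n.+1) : Prop :=
  forall (z : C) (k : nat), (k < eig_index M z)%N -> has_derivn D f k z.

(* The left-hand side is the derivative of a polynomial, the right-hand side
   the complex derivative of a function. *)
Definition hermite_interpolates (C : numClosedFieldType) (f : C -> C) n
    (M : 'M[C]_n.+1) (p : {poly C}) : Prop :=
  forall (z : C) (k : nat), (k < eig_index M z)%N ->
    (p^`(k)%R).[z] = (f^`(k)%classic) z.

(* f(M) = p(M) for any Hermite interpolant p of f on the spectrum of M; the
   value p(M) does not depend on the choice of p. *)
Definition matfun (C : numClosedFieldType) (f : C -> C) n (M : 'M[C]_n.+1) :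
    'M[C]_n.+1 :=
  horner_mx M (xget 0 [set p | hermite_interpolates f M p]).

(** ** Moore-Penrose inverse *)

(* [pinvmx] of mxalgebra is only some generalized inverse, hence this one. *)
Definition penrose (C : numClosedFieldType) m n
    (A : 'M[C]_(m, n)) (X : 'M[C]_(n, m)) : Prop :=
  [/\ A *m X *m A = A, X *m A *m X = X,
      (A *m X)^t* = A *m X & (X *m A)^t* = X *m A].

Definition mpinv (C : numClosedFieldType) m n (A : 'M[C]_(m, n)) :
    'M[C]_(n, m) :=
  xget 0 [set X | penrose A X].

(** ** Norms *)

Definition norm2 (R : realType) n (x : 'cV[R[i]]_n) : R :=
  Num.sqrt (\sum_i ComplexField.Normc.normc (x i 0) ^+ 2).

Definition spectral_norm (R : realType) m n (M : 'M[R[i]]_(m, n)) : R :=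
  sup [set norm2 (M *m x) | x in [set x : 'cV[R[i]]_n | norm2 x <= 1]].

(** ** Krylov spaces *)

Definition krylov (C : fieldType) N (A : 'M[C]_N) (b : 'cV[C]_N) (m : nat) :
    {vspace 'cV[C]_N} :=
  <<mkseq (fun i => A ^+ i *m b) m>>%VS.

(* Main.v *)
(** The matrix [(SV)^H S] is a left inverse of [V], so [V] has full column
    rank and [V^+ V = I].  Writing [b = V c], both [V^+ b] and [V^H S^H S b]
    equal [c], hence the two approximants differ by [V y] with [y] the
    difference of the two matrix functions applied to [c].  As [S V] is an
    isometry, the embedding gives [sqrt (1 - eps) |V y| <= |S V y| = |y|] and
    [|c| = |S b| <= sqrt (1 + eps) |b|]. *)

Require Import Defs.
From HB Require Import structures.
From mathcomp Require Import all_boot all_order all_algebra complex.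
From mathcomp Require Import boolp classical_sets reals topology normedtype.
From mathcomp Require Import derive.

Set Implicit Arguments.
Unset Strict Implicit.
Unset Printing Implicit Defensive.

Import Order.TTheory GRing.Theory Num.Theory.
Local Open Scope sesquilinear_scope.
Local Open Scope ring_scope.

Lemma adjmxM (C : numClosedFieldType) m n p
    (A : 'M[C]_(m, n)) (B : 'M[C]_(n, p)) :
  (A *m B)^t* = B^t* *m A^t*.
Proof. by rewrite trmx_mul map_mxM. Qed.

(** Each diagonal entry of [A *m A^t*] is the sum of the squared moduli along a row of [A], so its
    vanishing kills the whole row. *)
Lemma mulmx_adj_eq0 (C : numClosedFieldType) m n (A : 'M[C]_(m, n)) :
  A *m A^t* = 0 -> A = 0.
Proof.
move=> /matrixP AA0; apply/matrixP => i j; rewrite mxE.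
have: \sum_k `|A i k| ^+ 2 = 0.
  have := AA0 i i; rewrite !mxE => AA0i; rewrite -[RHS]AA0i.
  by apply: eq_bigr => k _; rewrite !mxE normCK.
move=> /psumr_eq0P Ai0; have /eqP := Ai0 (fun k _ => exprn_ge0 2 (normr_ge0 _)) j isT.
by rewrite expf_eq0 normr_eq0 => /eqP.
Qed.

(** If [u] annihilates the Gram matrix, then [u *m V^t*] times its own adjoint is zero, hence
    [u *m V^t* = 0]; the adjoint of [W *m V = 1%:M] then cancels [V^t*]. *)
Lemma gram_unitmx (C : numClosedFieldType) m n
    (V : 'M[C]_(m, n)) (W : 'M[C]_(n, m)) :
  W *m V = 1%:M -> V^t* *m V \in unitmx.
Proof.
move=> WV; rewrite -row_free_unit; apply: inj_row_free => u uG0.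
have uV0 : u *m V^t* = 0.
  apply: mulmx_adj_eq0.
  by rewrite adjmxM trmxCK mulmxA -(mulmxA u) uG0 mul0mx.
by rewrite -[u]mulmx1 -(map_mx1 Num.conj) -trmx1 -WV adjmxM mulmxA uV0 mul0mx.
Qed.

(** [mpinv] falls back to 0 when no Penrose inverse exists. Under full column rank the explicit
    witness $(V^H V)^{-1} V^H$ rules this out. *)
Lemma mpinvP (C : numClosedFieldType) m n
    (V : 'M[C]_(m, n)) (W : 'M[C]_(n, m)) :
  W *m V = 1%:M -> penrose V (mpinv V).
Proof.
move=> /gram_unitmx Gu; set G := V^t* *m V in Gu.
have adjG : (invmx G)^t* = invmx G.
  by rewrite trmx_inv map_invmx adjmxM trmxCK.
apply: (@xgetPex _ _ [set X | penrose V X]%classic).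
exists (invmx G *m V^t*).
have XV : invmx G *m V^t* *m V = 1%:M by rewrite -mulmxA mulVmx.
split.
- by rewrite -mulmxA XV mulmx1.
- by rewrite XV mul1mx.
- by rewrite !adjmxM trmxCK adjG mulmxA.
- by rewrite XV trmx1 map_mx1.
Qed.

Lemma mulVmpinv (C : numClosedFieldType) m n
    (V : 'M[C]_(m, n)) (W : 'M[C]_(n, m)) :
  W *m V = 1%:M -> mpinv V *m V = 1%:M.
Proof.
move=> WV; have [VXV _ _ _] := mpinvP WV.
(* Multiplying $V V^\dagger V = V$ on the left by [W] cancels the leading [V]. *)
by rewrite -[LHS]mul1mx -WV -mulmxA (mulmxA V) VXV.
Qed.

Lemma mem_span_colsP (K : fieldType) m n (V : 'M[K]_(m, n)) (v : 'cV[K]_m) :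
  reflect (exists c, v = V *m c)
    (v \in <<[seq col j V | j <- enum 'I_n]>>%VS).
Proof.
apply: (iffP idP) => [vV | [c ->]].
  have /subvP/(_ v vV)/memv_imgP[c _ ->] :
      (<<[seq col j V | j <- enum 'I_n]>> <= limg (linfun (mulmx V)))%VS.
    apply/span_subvP => _ /mapP[j _ ->].
    apply/memv_imgP; exists (delta_mx j 0); first exact: memvf.
    by rewrite lfunE /= colE.
  by exists c; rewrite lfunE.
have -> : V *m c = \sum_j c j 0 *: col j V.
  apply/colP => i; rewrite !mxE summxE.
  by apply: eq_bigr => j _; rewrite !mxE mulrC.
apply: rpred_sum => j _; apply/rpredZ/memv_span/map_f.
by rewrite mem_enum.
Qed.

Lemma krylov_subv (C : fieldType) N (A : 'M[C]_N) (b : 'cV_N) (k l : nat) :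
  (k <= l)%N -> (krylov A b k <= krylov A b l)%VS.
Proof.
move=> kl; apply/span_subvP => _ /mapP[j + ->].
rewrite mem_iota /= add0n => jk.
by apply/memv_span/map_f; rewrite mem_iota /= add0n (leq_trans jk).
Qed.

Lemma normc_ge0 (R : rcfType) (z : R[i]) : 0 <= ComplexField.Normc.normc z.
Proof. by case: z => a b; exact: sqrtr_ge0. Qed.

Lemma norm2_ge0 (R : realType) n (x : 'cV[R[i]]_n) : 0 <= norm2 x.
Proof. exact: sqrtr_ge0. Qed.

Lemma sqr_norm2 (R : realType) n (x : 'cV[R[i]]_n) :
  norm2 x ^+ 2 = \sum_i ComplexField.Normc.normc (x i 0) ^+ 2.
Proof. by rewrite sqr_sqrtr ?sumr_ge0 // => i _; rewrite sqr_ge0. Qed.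

(** Bridge from the real-valued norm to matrix algebra over [R[i]]: norm identities reduce to
    identities between products with adjoints. *)
Lemma sqr_norm2C (R : realType) n (x : 'cV[R[i]]_n) :
  (norm2 x ^+ 2)%:C%C = (x^t* *m x) 0 0.
Proof.
rewrite sqr_norm2 mxE rmorph_sum; apply: eq_bigr => i _.
by rewrite !mxE mulrC -normCK rmorphXn.
Qed.

Lemma norm2_isometry (R : realType) m n (Q : 'M[R[i]]_(m, n)) (x : 'cV_n) :
  Q^t* *m Q = 1%:M -> norm2 (Q *m x) = norm2 x.
Proof.
move=> QQ; apply/eqP; rewrite -(eqrXn2 (ltn0Sn 1)) ?norm2_ge0 //.
apply/eqP/complexI; rewrite !sqr_norm2C adjmxM mulmxA -(mulmxA _ _ Q) QQ.
by rewrite mulmx1.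
Qed.

Lemma norm2Z (R : realType) n (a : R) (x : 'cV[R[i]]_n) :
  0 <= a -> norm2 (a%:C%C *: x) = a * norm2 x.
Proof.
move=> a0; apply/eqP; rewrite -(eqrXn2 (ltn0Sn 1)) ?mulr_ge0 ?norm2_ge0 //.
rewrite exprMn !sqr_norm2 mulr_sumr; apply/eqP/eq_bigr => i _.
rewrite mxE ComplexField.Normc.normcM exprMn; congr (_ * _).
by rewrite /= expr0n addr0 sqr_sqrtr ?sqr_ge0.
Qed.

Lemma norm2_0 (R : realType) n : norm2 (0 : 'cV[R[i]]_n) = 0.
Proof.
rewrite /norm2 big1 ?sqrtr0 // => i _.
by rewrite mxE ComplexField.Normc.normc0 expr0n.
Qed.

Lemma norm2_eq0 (R : realType) n (x : 'cV[R[i]]_n) : norm2 x = 0 -> x = 0.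
Proof.
move=> x0; rewrite -[x]trmxCK (_ : x^t* = 0) ?trmx0 ?map_mx0 //.
apply: mulmx_adj_eq0; rewrite trmxCK.
by apply/matrixP => i j; rewrite !ord1 -sqr_norm2C x0 expr0n mxE.
Qed.

Lemma normc_le_norm2 (R : realType) n (x : 'cV[R[i]]_n) i :
  ComplexField.Normc.normc (x i 0) <= norm2 x.
Proof.
rewrite -(@ler_pXn2r _ 2) ?nnegrE ?norm2_ge0 ?normc_ge0 //.
rewrite sqr_norm2 (bigD1 i) //= lerDl sumr_ge0 // => j _; exact: sqr_ge0.
Qed.

(* Without this, the [sup] in [spectral_norm] could be a junk value. *)
Lemma spectral_norm_has_ubound (R : realType) m n (M : 'M[R[i]]_(m, n)) :
  has_ubound [set norm2 (M *m x) | x in [set x : 'cV[R[i]]_n | norm2 x <= 1]]%classic.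
Proof.
(* Every entry of a vector in the unit ball has modulus at most 1, so entry [i] of [M *m x] is
   bounded by the absolute sum of row [i]. *)
exists (Num.sqrt (\sum_i (\sum_j ComplexField.Normc.normc (M i j)) ^+ 2)).
move=> _ [x /= x1 <-]; rewrite ler_sqrt; last first.
  by apply: sumr_ge0 => i _; exact: sqr_ge0.
apply: ler_sum => i _.
rewrite ler_pXn2r ?nnegrE ?normc_ge0 ?sumr_ge0 //; last first.
  by move=> j _; exact: normc_ge0.
rewrite mxE; elim/big_ind2: _ => [|a1 a2 b1 b2 ha hb|j _].
- by rewrite ComplexField.Normc.normc0.
- exact: le_trans (le_normcD _ _) (lerD ha hb).
- rewrite ComplexField.Normc.normcM ler_piMr ?normc_ge0 //.
  exact: le_trans (normc_le_norm2 _ _) x1.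
Qed.

Lemma spectral_norm_ge0 (R : realType) m n (M : 'M[R[i]]_(m, n)) :
  0 <= spectral_norm M.
Proof.
apply: (ub_le_sup (spectral_norm_has_ubound M)).
by exists 0; rewrite /= ?mulmx0 norm2_0.
Qed.

(** For nonzero [x], the normalized vector lies in the unit ball over which the supremum is taken;
    the zero vector is treated apart. *)
Lemma norm2_mulmx_le (R : realType) m n (M : 'M[R[i]]_(m, n)) (x : 'cV_n) :
  norm2 (M *m x) <= spectral_norm M * norm2 x.
Proof.
have [x0|x_neq0] := eqVneq (norm2 x) 0.
  by rewrite x0 (norm2_eq0 x0) mulmx0 norm2_0 mulr0.
have x_gt0 : 0 < norm2 x by rewrite lt_neqAle eq_sym x_neq0 norm2_ge0.
have inv_ge0 : 0 <= (norm2 x)^-1 by rewrite invr_ge0 norm2_ge0.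
rewrite -ler_pdivrMr // mulrC -norm2Z // scalemxAr.
apply: (ub_le_sup (spectral_norm_has_ubound M)).
exists ((norm2 x)^-1%:C%C *: x) => //=.
by rewrite norm2Z // mulVf.
Qed.

Theorem corollary2p4 (R : realType) (N m s : nat)
    (A : 'M[R[i]]_N) (b : 'cV[R[i]]_N) (V : 'M[R[i]]_(N, m.+1))
    (eps : R) (S : 'M[R[i]]_(s, N)) (D : set R[i]) (f : R[i] -> R[i])
    (Vbasis : basis_of (krylov A b m.+1) [seq col j V | j <- enum 'I_m.+1])
    (eps_ge0 : 0 <= eps) (eps_lt1 : eps < 1)
    (Sembed : forall v : 'cV[R[i]]_N, v \in krylov A b m.+2 ->
      (1 - eps) * norm2 v ^+ 2 <= norm2 (S *m v) ^+ 2
        <= (1 + eps) * norm2 v ^+ 2)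
    (SVorth : (S *m V)^t* *m (S *m V) = 1%:M)
    (fdef : defined_on_spectrum D f (mpinv V *m A *m V))
    (fdefS : defined_on_spectrum D f (V^t* *m S^t* *m S *m A *m V)) :
  let fom := V *m matfun f (mpinv V *m A *m V) *m mpinv V *m b in
  let sfom := V *m matfun f (V^t* *m S^t* *m S *m A *m V)
                *m V^t* *m S^t* *m S *m b in
  norm2 (fom - sfom) <=
    Num.sqrt ((1 + eps) / (1 - eps)) * norm2 b *
    spectral_norm (matfun f (mpinv V *m A *m V)
                   - matfun f (V^t* *m S^t* *m S *m A *m V)).
Proof.
move=> /=.
set F := matfun f _; set G := matfun f _.
pose W := V^t* *m S^t* *m S.
have WV : W *m V = 1%:M by rewrite /W -!mulmxA mulmxA -adjmxM.
have spanV : <<[seq col j V | j <- enum 'I_m.+1]>>%VS = krylov A b m.+1.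
  exact: span_basis.
have bK : b \in krylov A b m.+1.
  apply: (subvP (krylov_subv _ _ (ltn0Sn m))); apply/memv_span; rewrite inE.
  by rewrite expr0 mul1mx.
(* The basis has [m.+1] columns, so the $m$ of the informal statement is [m.+1] here and the
   embedding holds on the Krylov space of index [m.+2]. Both vectors to be sketched, [b] and
   [V *m y], lie in the smaller space of index [m.+1]. *)
have bK2 : b \in krylov A b m.+2 by apply: subvP bK; exact: krylov_subv.
have VK2 c : V *m c \in krylov A b m.+2.
  apply: (subvP (krylov_subv _ _ (leqnSn m.+1))).
  by rewrite -spanV; apply/mem_span_colsP; exists c.
have [c bE] : exists c, b = V *m c by apply/mem_span_colsP; rewrite spanV.
have -> : V *m F *m mpinv V *m b - V *m G *m V^t* *m S^t* *m S *m b =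
    V *m ((F - G) *m c).
  have -> : V *m G *m V^t* *m S^t* *m S *m b = V *m G *m (W *m b).
    by rewrite /W !mulmxA.
  rewrite -(mulmxA _ _ b) {1}bE (mulmxA (mpinv V)) (mulVmpinv WV) mul1mx.
  by rewrite bE (mulmxA W) WV mul1mx -!mulmxA -mulmxBr -mulmxBl.
set y := (F - G) *m c.
have norm2SV z : norm2 (S *m (V *m z)) = norm2 z.
  by rewrite mulmxA norm2_isometry.
have eps'_gt0 : 0 < 1 - eps by rewrite subr_gt0.
have eps'_ge0 : 0 <= 1 - eps := ltW eps'_gt0.
have epsD_ge0 : 0 <= 1 + eps by rewrite addr_ge0.
have leV : Num.sqrt (1 - eps) * norm2 (V *m y) <= norm2 y.
  rewrite -(@ler_pXn2r _ 2) ?nnegrE ?mulr_ge0 ?sqrtr_ge0 ?norm2_ge0 //.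
  rewrite -(norm2SV y) exprMn (sqr_sqrtr eps'_ge0).
  by case/andP: (Sembed _ (VK2 y)).
have leb : norm2 c <= Num.sqrt (1 + eps) * norm2 b.
  rewrite -(@ler_pXn2r _ 2) ?nnegrE ?mulr_ge0 ?sqrtr_ge0 ?norm2_ge0 //.
  rewrite -(norm2SV c) -bE exprMn (sqr_sqrtr epsD_ge0).
  by case/andP: (Sembed _ bK2).
(* The factor $1/\sqrt{1-\varepsilon}$ moves to the left, where [leV] absorbs it; what remains is
   the operator bound on [y] followed by [leb]. *)
rewrite sqrtrM // sqrtrV // [X in X * norm2 b]mulrC -!mulrA.
rewrite ler_pdivlMl ?sqrtr_gt0 //; apply: le_trans leV _.
apply: le_trans (norm2_mulmx_le _ _) _; rewrite mulrA mulrC.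
exact: ler_wpM2r (spectral_norm_ge0 _) _ _ leb.
Qed.
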